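(* Let $v_i \in V$ be a vertex of $\Delta$ and $t_{ijk} \in T$ a triangle of $\Delta$ (with a vertex at $v_i$). Suppose that (a) the points $v_k$, $v_{ijk}$, $v_{ij}$ are collinear, and $t_{ijk'} \in T$ is the second triangle of $\Delta$ attached to $e_{ij}$ if $e_{ij} \in E \setminus E^b$ is an interior edge; (b) the points $v_j$, $v_{ijk}$, $v_{ki}$ are collinear, and $t_{kij'} \in T$ is the second triangle of $\Delta$ attached to $e_{ki}$ if $e_{ki} \in E \setminus E^b$ is an interior edge. Then, the restriction of a spline $S \in \mathbb{S}_3^1(\Delta_{\mathrm{PS}})$ to $t_{i,j,k} \cup t_{i,k,j}$ is $C^2$ smooth across the edge $[v_i, v_{ijk}]$ if and only if $$(1 - \nu_{ij,k})\, \beta_{i,j,k}^t(S) + \nu_{ij,k}\, b_{ij}(S) = (1 - \nu_{ki,j})\, \beta_{i,k,j}^t(S) + \nu_{ki,j}\, b_{ik}(S)$$ and $$\beta_{j,k,i}^t(S) = \beta_{k,j,i}^t(S),$$ where $b_{ij}(S)=\beta_{i,j,k'}^t(S)$ if $e_{ij} \in E \setminus E^b$ and $b_{ij}(S)=\beta_{i,j}^e(S)$ if $e_{ij} \in E^b$, and $b_{ik}(S)=\beta_{i,k,j'}^t(S)$ if $e_{ki} \in E \setminus E^b$ and $b_{ik}(S)=\beta_{i,k}^e(S)$ if $e_{ki} \in E^b$.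
   Context: Triangulation. $\Omega\subset\mathbb{R}^2$ is a polygonal domain and $\Delta=(V,E,T)$ is a triangulation of it: $V=\{v_i\}$ is a finite set of vertices (points), $E=\{e_{ij}\}$ a finite set of edges $e_{ij}=[v_i,v_j]$ and $T=\{t_{ijk}\}$ a finite set of nondegenerate triangles $t_{ijk}=[v_i,v_j,v_k]$, where $[\cdot]$ denotes the convex hull. The union of the triangles is $\Omega$, two different triangles intersect in the empty set, an element of $V$ or an element of $E$, and every vertex and edge belongs to at least one triangle. $E^b\subseteq E$ is the set of edges on the boundary of $\Omega$; an edge of $E\setminus E^b$ is shared by two triangles, an edge of $E^b$ belongs to one. Index convention: indices not separated by a comma may be permuted ($a_{ij}=a_{ji}$, $a_{ij,k}=a_{ji,k}$), while the order of comma-separated indices matters. Powell--Sabin refinement. $\Delta_{\mathrm{PS}}=(V_{\mathrm{PS}},E_{\mathrm{PS}},T_{\mathrm{PS}})$ is obtained as follows. A split point $v_{ijk}$ is chosen inside each $t_{ijk}\in T$ so that for every interior edge $e_{ij}$ shared by $t_{ijk},t_{ijk'}\in T$ the segment $[v_{ijk},v_{ijk'}]$ intersects $e_{ij}$ in a point $v_{ij}$ inside $e_{ij}$; for $e_{ij}\in E^b$, $v_{ij}$ is an arbitrary point inside $e_{ij}$. Each $t_{ijk}$ is split into six triangles: $t_{i,j,k}=[v_i,v_{ij},v_{ijk}]$ and the triangles $t_{j,i,k},t_{j,k,i},t_{k,j,i},t_{k,i,j},t_{i,k,j}$ defined by the same rule ($t_{a,b,c}=[v_a,v_{ab},v_{abc}]$).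 These form $T_{\mathrm{PS}}$. Also $e_{i,j}=[v_i,v_{ij}]$. Blossom. $\mathbb{P}_3$ is the space of bivariate polynomials of total degree at most 3. For $P\in\mathbb{P}_3$, the blossom $\mathcal{B}[P]:(\mathbb{R}^2)^3\to\mathbb{R}$ is the unique symmetric map that is affine in each argument and satisfies $\mathcal{B}[P](p,p,p)=P(p)$. For a spline $S$, $\mathcal{B}[S|_{t}]$ is the blossom of the polynomial coinciding with $S$ on $t$; for a boundary half-edge $e_{i,j}$ ($e_{ij}\in E^b$), $\mathcal{B}[S|_{e_{i,j}}](v_i,v_j,v_{ij})$ is the blossom of the polynomial piece on the triangle of $T_{\mathrm{PS}}$ containing $e_{i,j}$. Spline space and functionals. $\mathbb{S}_3^1(\Delta_{\mathrm{PS}})=\{S\in C^1(\Omega): S|_{t}\in\mathbb{P}_3 \text{ for all } t\in T_{\mathrm{PS}}\}$. For $t_{i,j,k}\in T_{\mathrm{PS}}$, $\beta^t_{i,j,k}(S)=\mathcal{B}[S|_{t_{i,j,k}}](v_i,v_j,v_{ijk})$; for $e_{ij}\in E^b$, $\beta^e_{i,j}(S)=\mathcal{B}[S|_{e_{i,j}}](v_i,v_j,v_{ij})$. Weights. If $v_k,v_{ijk},v_{ij}$ are collinear, $\nu_{ij,k}\in\mathbb{R}$ is the number such that $v_k=(1-\nu_{ij,k})v_{ijk}+\nu_{ij,k}v_{ijk'}$ if $e_{ij}\in E\setminus E^b$ (with $t_{ijk'}$ the second triangle attached to $e_{ij}$), and $v_k=(1-\nu_{ij,k})v_{ijk}+\nu_{ij,k}v_{ij}$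 if $e_{ij}\in E^b$. Analogously, $\nu_{ki,j}$ satisfies $v_j=(1-\nu_{ki,j})v_{ijk}+\nu_{ki,j}v_{kij'}$ if $e_{ki}\in E\setminus E^b$ and $v_j=(1-\nu_{ki,j})v_{ijk}+\nu_{ki,j}v_{ki}$ if $e_{ki}\in E^b$. Smoothness. $S$ is $C^2$ smooth across an edge of $\Delta_{\mathrm{PS}}$ if the polynomial pieces on the two triangles of $T_{\mathrm{PS}}$ sharing it have equal partial derivatives up to order 2 along it. *)

(* Defs.v *)
From HB Require Import structures.
From mathcomp Require Import all_boot all_order all_algebra.
From mathcomp Require Import all_classical all_reals all_analysis.
(* The notations of [mpoly] clash with those of MathComp-Analysis. *)
From mathcomp Require Import -(notations) mpoly.

Set Implicit Arguments.
Unset Strict Implicit.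
Unset Printing Implicit Defensive.

Import Order.TTheory GRing.Theory Num.Theory.
Import numFieldNormedType.Exports.

Local Open Scope classical_set_scope.
Local Open Scope ring_scope.

Notation plane R := 'rV[R]_2.

Section Geometry.
Variable R : realType.

Definition hull (J : finType) (x : J -> plane R) (A : {set J}) : set (plane R) :=
  [set p | exists w : J -> R,
    [/\ forall i, 0 <= w i, \sum_(i in A) w i = 1
      & p = \sum_(i in A) w i *: x i]].

(* All weights are positive: the relative interior of a segment or of a
   nondegenerate triangle. *)
Definition inside (J : finType) (x : J -> plane R) (A : {set J})
    : set (plane R) :=
  [set p | exists w : J -> R,
    [/\ forall i, 0 < w i, \sum_(i in A) w i = 1
      & p = \sum_(i in A) w i *: x i]].

Definition chull (s : seq (plane R)) : set (plane R) :=
  hull (fun k : 'I_(size s) => s`_k) [set: 'I_(size s)]%SET.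

Definition collinear (a b c : plane R) : Prop :=
  exists o d : plane R, forall x, x \in [:: a; b; c] ->
    exists s : R, x = o + s *: d.

(* Indices of vertices stand for vertices; an edge [v_i, v_j] and a triangle
   [v_i, v_j, v_k] are stored as the sets {i, j} and {i, j, k}. *)
Definition eset (I : finType) (i j : I) : {set I} := [set i; j]%SET.
Definition tset (I : finType) (i j k : I) : {set I} := [set i; j; k]%SET.

(* The set E^b of the edges lying on the topological boundary of Omega. *)
Definition boundary_edges (Omega : set (plane R)) (I : finType)
    (v : I -> plane R) (E : {set {set I}}) : {set {set I}} :=
  [set e in E | `[< hull v e `<=` closure Omega `\` interior Omega >]]%SET.

Record triangulation (Omega : set (plane R)) := Triangulation {
  vidx : finType ;
  vtx : vidx -> plane R ;
  edges : {set {set vidx}} ;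
  triangles : {set {set vidx}} ;
  Omega_connected : connected Omega ;
  vtx_inj : injective vtx ;
  edge_card : forall e, e \in edges -> #|e| = 2%N ;
  triangle_card : forall t, t \in triangles -> #|t| = 3%N ;
  triangle_nondegenerate : forall i j k, tset i j k \in triangles ->
    ~ collinear (vtx i) (vtx j) (vtx k) ;
  triangle_sides : forall (t e : {set vidx}),
    t \in triangles -> e \subset t -> #|e| = 2%N -> e \in edges ;
  triangles_cover :
    Omega = [set p | exists2 t, t \in triangles & hull vtx t p] ;
  triangles_meet : forall t t', t \in triangles -> t' \in triangles -> t != t' ->
    [\/ hull vtx t `&` hull vtx t' = set0,
        exists i, hull vtx t `&` hull vtx t' = [set vtx i]
      | exists2 e, e \in edges & hull vtx t `&` hull vtx t' = hull vtx e] ;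
  vertex_in_triangle : forall i, exists2 t, t \in triangles & i \in t ;
  edge_in_triangle : forall e, e \in edges ->
    exists2 t, t \in triangles & e \subset t ;
  interior_edge_card : forall e,
    e \in edges -> e \notin boundary_edges Omega vtx edges ->
    #|[set t in triangles | e \subset t]%SET| = 2%N ;
  boundary_edge_card : forall e, e \in boundary_edges Omega vtx edges ->
    #|[set t in triangles | e \subset t]%SET| = 1%N
}.

Definition bedges (Omega : set (plane R)) (D : triangulation Omega) :
  {set {set vidx D}} := boundary_edges Omega (@vtx _ D) (edges D).

(* [vsplit t] is the split point of the triangle [t] and [vmid e] the point
   chosen on the edge [e]. *)
Record ps_refinement (Omega : set (plane R)) (D : triangulation Omega) :=
    PSRefinement {
  vsplit : {set vidx D} -> plane R ;
  vmid : {set vidx D} -> plane R ;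
  vsplit_inside : forall t, t \in triangles D ->
    inside (@vtx _ D) t (vsplit t) ;
  vmid_inside : forall e, e \in edges D -> inside (@vtx _ D) e (vmid e) ;
  vmid_interior : forall e t t', e \in edges D -> e \notin bedges D ->
    t \in triangles D -> t' \in triangles D -> t != t' ->
    e \subset t -> e \subset t' ->
    chull [:: vsplit t; vsplit t'] `&` hull (@vtx _ D) e = [set vmid e]
}.

End Geometry.

Section Splines.
Variable R : realType.

Definition peval (P : mpoly 2 R) (p : plane R) : R :=
  meval (fun c => p ord0 c) P.

Definition cubic (P : mpoly 2 R) : Prop := (mmeasure mdeg P <= 4)%N.

Definition affine (f : plane R -> R) : Prop := forall (s : R) (x y : plane R),
  f ((1 - s) *: x + s *: y) = (1 - s) * f x + s * f y.

Definition is_blossom (P : mpoly 2 R)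
    (B : plane R -> plane R -> plane R -> R) : Prop :=
  [/\ forall x y z, B x y z = B y x z /\ B x y z = B x z y,
      forall x y, [/\ affine (fun z => B z x y), affine (fun z => B x z y)
                    & affine (fun z => B x y z)]
    & forall p, B p p p = peval P p].

Definition blossom (P : mpoly 2 R) :
    plane R -> plane R -> plane R -> R :=
  xget (fun _ _ _ => 0) [set B | is_blossom P B].

(* The polynomial of P_3 that coincides with S on t. *)
Definition piece (S : plane R -> R) (t : set (plane R)) : mpoly 2 R :=
  xget 0 [set P | cubic P /\ forall p, t p -> S p = peval P p].

(* C^1 up to the boundary: the partial derivatives in the interior of Omega
   extend continuously to Omega. *)
Definition C1 (Omega : set (plane R)) (S : plane R -> R) : Prop :=
  {within Omega, continuous S} /\
  forall c : 'I_2, exists2 g : plane R -> R, {within Omega, continuous g} &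
    forall p, interior Omega p -> is_derive p (delta_mx ord0 c) S (g p).

(* Equal partial derivatives up to order 2 along e; m is the multi-index. *)
Definition C2_across (S : plane R -> R) (t t' e : set (plane R)) : Prop :=
  forall (p : plane R) (m : multinom 2), e p -> (mdeg m <= 2)%N ->
    peval (mderivm m (piece S t)) p =
    peval (mderivm m (piece S t')) p.

Variables (Omega : set (plane R)) (D : triangulation Omega).
Variable PS : ps_refinement D.
Local Notation v := (@vtx _ _ D).

(* The triangle t_{i,j,k} = [v_i, v_ij, v_ijk]. *)
Definition ps_triangle (i j k : vidx D) : set (plane R) :=
  chull [:: v i; vmid PS (eset i j); vsplit PS (tset i j k)].

Definition ps_spline (S : plane R -> R) : Prop :=
  C1 Omega S /\
  forall i j k, tset i j k \in triangles D ->
    exists2 P, cubic P & forall p, ps_triangle i j k p -> S p = peval P p.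

Definition beta_t (S : plane R -> R) (i j k : vidx D) : R :=
  blossom (piece S (ps_triangle i j k)) (v i) (v j) (vsplit PS (tset i j k)).

(* For a boundary edge e_ij, the triangle containing the half-edge [v_i, v_ij]
   is t_{i,j,k} for the only k such that t_ijk is a triangle. *)
Definition beta_e (S : plane R -> R) (i j : vidx D) : R :=
  if [pick k | tset i j k \in triangles D] is Some k then
    blossom (piece S (ps_triangle i j k)) (v i) (v j) (vmid PS (eset i j))
  else 0.

(* The weight nu_{ij,k}; k' is the third index of the second triangle attached
   to e_ij and is not used when e_ij is on the boundary. *)
Definition nu (i j k k' : vidx D) : R :=
  xget 0 [set n : R | v k = (1 - n) *: vsplit PS (tset i j k) +
    n *: (if eset i j \in bedges D then vmid PS (eset i j)
          else vsplit PS (tset i j k'))].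

(* b_ij(S), with the same k'. *)
Definition b_val (S : plane R -> R) (i j k' : vidx D) : R :=
  if eset i j \in bedges D then beta_e S i j else beta_t S i j k'.

End Splines.

(* Main.v *)
(* Write P_(i,j,k) for the polynomial piece on t_{i,j,k} and B_(i,j,k) for its
   blossom, and z for the split point.  C^1 contact of two pieces along a segment
   means that their blossoms agree as soon as two arguments lie on the line of
   the segment.  Given C^1 contact of P_(i,j,k) and P_(i,k,j) along [v_i, z],
   C^2 contact amounts to equality of the blossoms at (v_i, v_j, v_k) and at
   (z, v_j, v_k).  By collinearity of v_k, z and v_ij, C^1 contact across
   [z, v_ij] and [z, v_j] turns B_(i,j,k)(z, v_j, v_k) into beta_(j,k,i), while
   expanding v_k by its weight nu and using C^1 contact across [v_i, v_ij] turns
   B_(i,j,k)(v_i, v_j, v_k) into (1 - nu) beta_(i,j,k) + nu b_ij; symmetrically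
   for B_(i,k,j). *)
Require Import Defs.
From mathcomp Require Import all_boot all_order all_algebra.
From mathcomp Require Import all_classical all_reals all_analysis.
From mathcomp Require Import -(notations) mpoly.
From mathcomp Require Import ring lra.

Set Implicit Arguments.
Unset Strict Implicit.
Unset Printing Implicit Defensive.

Import Order.TTheory GRing.Theory Num.Theory.
Import numFieldNormedType.Exports.

Local Open Scope classical_set_scope.
Local Open Scope ring_scope.

(** * Blossoms of cubic polynomials and their derivatives *)

Section Blossoms.
Variable R : realType.
Implicit Types (P Q : mpoly 2 R) (x y z p u w : plane R).

(* The polarization formula, which yields the blossom when [P] is cubic. *)
Definition polar P x y z : R :=
  (27 * peval P (3^-1 *: (x + y + z))
   - 8 * (peval P (2^-1 *: (x + y)) + peval P (2^-1 *: (y + z))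
          + peval P (2^-1 *: (x + z)))
   + (peval P x + peval P y + peval P z)) / 6.

Lemma affineM (f : plane R -> R) (s t : R) x y :
  affine f -> s + t = 1 -> f (s *: x + t *: y) = s * f x + t * f y.
Proof. by move=> af st; have -> : s = 1 - t by lra. Qed.

(** Uniqueness of the blossom: the diagonal values at the centroid, the midpoints and the points
    themselves expand by affinity and symmetry, and the weights 27, -8, 1 cancel everything except
    six copies of [B x y z]. *)
Lemma is_blossom_polar P B : is_blossom P B -> forall x y z, B x y z = polar P x y z.
Proof.
move=> [Bs Ba Bd] x y z.
have B1 u w s t a b : s + t = 1 -> B (s *: u + t *: w) a b = s * B u a b + t * B w a b.
  by move=> st; apply: (@affineM (fun z => B z a b)) st; case: (Ba a b).
have B2 u w s t a b : s + t = 1 -> B a (s *: u + t *: w) b = s * B a u b + t * B a w b.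
  by move=> st; apply: (@affineM (fun z => B a z b)) st; case: (Ba a b).
have B3 u w s t a b : s + t = 1 -> B a b (s *: u + t *: w) = s * B a b u + t * B a b w.
  by move=> st; apply: (@affineM (fun z => B a b z)) st; case: (Ba a b).
have half u w : 2^-1 *: (u + w) = 2^-1 *: u + 2^-1 *: w :> plane R by rewrite scalerDr.
(* The centroid is split into two nested binary combinations, since [affine] speaks of two points
   only. *)
have third : 3^-1 *: (x + y + z) = (2 / 3) *: (2^-1 *: x + 2^-1 *: y) + 3^-1 *: z.
  by apply/rowP => c; rewrite !mxE; by field.
have h2 : 2^-1 + 2^-1 = 1 :> R by field.
have h3 : 2 / 3 + 3^-1 = 1 :> R by field.
rewrite /polar third !half -!Bd !(B1 _ _ _ _ _ _ h3, B2 _ _ _ _ _ _ h3, B3 _ _ _ _ _ _ h3).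
rewrite !(B1 _ _ _ _ _ _ h2, B2 _ _ _ _ _ _ h2, B3 _ _ _ _ _ _ h2).
(* Each value of [B] gets one fixed order of arguments, so that [field] meets equal atoms. *)
have s1 a b c : B a b c = B b a c by case: (Bs a b c).
have s2 a b c : B a b c = B a c b by case: (Bs a b c).
have perm a b : B a b a = B a a b /\ B b a a = B a a b by split; rewrite // s1.
have [[yxx1 yxx2] [zxx1 zxx2]] := (perm x y, perm x z).
have [[xyy1 xyy2] [zyy1 zyy2]] := (perm y x, perm y z).
have [[xzz1 xzz2] [yzz1 yzz2]] := (perm z x, perm z y).
have [xzy zxy] : B x z y = B x y z /\ B z x y = B x y z by split; rewrite // s1.
have [yzx zyx] : B y z x = B x y z /\ B z y x = B x y z.
  by split; rewrite ?[B z y x]s1 s2 s1.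
rewrite ?(yxx1, yxx2, zxx1, zxx2, xyy1, xyy2, zyy1, zyy2, xzz1, xzz2, yzz1, yzz2).
rewrite ?(xzy, zxy, yzx, zyx) ?[B y x z]s1.
by field.
Qed.

Lemma pevalXE (m : multinom 2) p :
  peval (@mpolyX 2 R m) p = p ord0 0 ^+ m 0 * p ord0 1 ^+ m 1.
Proof.
rewrite /peval mevalX !big_ord_recl big_ord0 mulr1.
by congr (_ * _ ^+ m _); [congr (p _ _)|]; apply: val_inj.
Qed.

(** Statements linear in the polynomial reduce to the monomials of degree at most 3, which
    [monomial_ind] then enumerates. *)
Lemma cubic_ind (F : mpoly 2 R -> Prop) :
  F 0 -> (forall P Q, F P -> F Q -> F (P + Q)) -> (forall a P, F P -> F (a *: P)) ->
  (forall m : multinom 2, (m 0%R + m 1%R <= 3)%N -> F (@mpolyX 2 R m)) ->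
  forall P, cubic P -> F P.
Proof.
move=> F0 FD FZ FX P cP; rewrite (mpolyE P) big_seq.
elim/big_ind: _ => // m mP; apply: FZ; apply: FX.
(* [mmeasure mdeg] is one more than the degree, so the bound 4 in [cubic] means degree at most 3. *)
have : (mdeg m < 4)%N by exact: leq_trans (mmeasure_mnm_lt _ mP) cP.
rewrite mdegE !big_ord_recl big_ord0 addn0 ltnS.
by rewrite (_ : lift ord0 ord0 = 1) //; apply: val_inj.
Qed.

Lemma sum_ord2 (V : zmodType) (f : 'I_2 -> V) : \sum_c f c = f 0 + f 1.
Proof.
rewrite !big_ord_recl big_ord0 addr0; congr (_ + f _); exact: val_inj.
Qed.

Lemma monomial_ind (F : nat -> nat -> Prop) :
  F 0%N 0%N -> F 1%N 0%N -> F 0%N 1%N -> F 2 0%N -> F 1%N 1%N -> F 0%N 2 ->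
  F 3 0%N -> F 2 1%N -> F 1%N 2 -> F 0%N 3 ->
  forall a b, (a + b <= 3)%N -> F a b.
Proof.
move=> ? ? ? ? ? ? ? ? ? ?.
by move=> [|[|[|[|a]]]] [|[|[|[|b]]]].
Qed.

Lemma pevalD P Q p : peval (P + Q) p = peval P p + peval Q p.
Proof. exact: mevalD. Qed.

Lemma pevalZ a P p : peval (a *: P) p = a * peval P p.
Proof. exact: mevalZ. Qed.

Lemma peval0 p : peval (0 : mpoly 2 R) p = 0.
Proof. exact: meval0. Qed.

Lemma polarD P Q x y z : polar (P + Q) x y z = polar P x y z + polar Q x y z.
Proof. by rewrite /polar !pevalD; field. Qed.

Lemma polarZ a P x y z : polar (a *: P) x y z = a * polar P x y z.
Proof. by rewrite /polar !pevalZ; field. Qed.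

Lemma polar0 x y z : polar 0 x y z = 0.
Proof. by rewrite /polar !peval0; field. Qed.

Lemma polar_affine P x y : cubic P -> affine (fun z => polar P x y z).
Proof.
move=> cP s u w; move: P cP; apply: cubic_ind => [|P Q hP hQ|a P hP|m].
- by rewrite !polar0; ring.
- by rewrite !polarD hP hQ; ring.
- by rewrite !polarZ hP; ring.
rewrite /polar !pevalXE !mxE.
move: (m 0) (m 1); apply: monomial_ind; by field.
Qed.

Lemma polar_diag P p : polar P p p p = peval P p.
Proof.
rewrite /polar.
have -> : 3^-1 *: (p + p + p) = p by apply/rowP => c; rewrite !mxE; by field.
have -> : 2^-1 *: (p + p) = p by apply/rowP => c; rewrite !mxE; by field.
by field.
Qed.

Lemma polarC12 P x y z : polar P x y z = polar P y x z.
Proof.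
rewrite /polar (addrC y x); congr (_ / _); ring.
Qed.

Lemma polarC23 P x y z : polar P x y z = polar P x z y.
Proof.
rewrite /polar (addrAC x z y) (addrC z y); congr (_ / _); ring.
Qed.

Lemma is_blossom_of_polar P : cubic P -> is_blossom P (polar P).
Proof.
move=> cP; split=> [x y z|x y|p].
- by split; [exact: polarC12|exact: polarC23].
- split; [move=> s u w|move=> s u w|exact: polar_affine].
  + by rewrite !(polarC12 P _ x) !(polarC23 P x _ y); exact: polar_affine.
  + by rewrite !(polarC23 P x _ y); exact: polar_affine.
- exact: polar_diag.
Qed.

(** [is_blossom_of_polar] shows that the choice in [blossom] is made from a nonempty set, and
    [is_blossom_polar] that this set has only one element. *)
Lemma blossomE P : cubic P -> blossom P = polar P.
Proof.
move=> cP; apply/funext => x; apply/funext => y; apply/funext => z.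
apply: is_blossom_polar; rewrite /blossom.
apply: (@xgetPex _ _ [set B | is_blossom P B]).
by exists (polar P); exact: is_blossom_of_polar.
Qed.

(** Differentiating the diagonal of a symmetric triaffine map gives three equal contributions, one
    for each argument; hence the factor 3. *)
Lemma polar_deriv P p u : cubic P ->
  3 * (polar P p p (p + u) - peval P p) =
  \sum_c u ord0 c * peval (mderiv c P) p.
Proof.
move: P; apply: cubic_ind => [|P Q hP hQ|a P hP|m].
- by rewrite polar0 sum_ord2 !mderiv0 !peval0; ring.
- move: hP hQ; rewrite polarD !sum_ord2 !mderivD !pevalD => hP hQ; lra.
- by move: hP; rewrite polarZ !sum_ord2 !mderivZ !pevalZ => hP; nra.
(* The truncated exponent [m c - 1] is harmless at [m c = 0], because the coefficient [m c] vanishes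
   there. *)
rewrite sum_ord2 !mderivX /polar !pevalZ !pevalXE !mnmBE !mnm1E !mxE /=.
move: (m 0) (m 1); apply: monomial_ind; rewrite ?subn1 ?subn0 /=; by field.
Qed.

(** The mixed second difference of the blossom; 6 counts the ordered choices of two of its three
    arguments. *)
Lemma polar_deriv2 P p u w : cubic P ->
  6 * (polar P p (p + u) (p + w) - polar P p p (p + u) - polar P p p (p + w)
       + peval P p) =
  \sum_c \sum_d u ord0 c * w ord0 d * peval (mderiv d (mderiv c P)) p.
Proof.
move: P; apply: cubic_ind => [|P Q hP hQ|a P hP|m].
- by rewrite !polar0 !sum_ord2 !mderiv0 !peval0; ring.
- move: hP hQ; rewrite !polarD !sum_ord2 !mderivD !pevalD => hP hQ; lra.
- by move: hP; rewrite !polarZ !sum_ord2 !mderivZ !pevalZ => hP; nra.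
rewrite !sum_ord2 !mderivX !mderivZ !mderivX /polar !pevalZ !pevalXE !mnmBE !mnm1E !mxE /=.
move: (m 0) (m 1); apply: monomial_ind; rewrite ?subn1 ?subn0 /=; by field.
Qed.

End Blossoms.

(** * First and second order contact of two cubics along a segment *)

Section Contact.
Variable R : realType.
Implicit Types (P Q : mpoly 2 R) (x y z p q u w : plane R).

Lemma polar_comb P (s t : R) x y p q : cubic P -> s + t = 1 ->
  polar P p q (s *: x + t *: y) = s * polar P p q x + t * polar P p q y.
Proof. by move=> cP; apply: affineM; exact: polar_affine. Qed.

Lemma polar_comb3 P (s t r : R) x y z p q : cubic P -> s + t + r = 1 ->
  polar P p q (s *: x + t *: y + r *: z) =
  s * polar P p q x + t * polar P p q y + r * polar P p q z.
Proof.
(* When [s + t = 0] the first two weights cannot be normalised; then [r = 1], and the point is the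
   reflection of [y] in a midpoint. *)
move=> cP str; have [s0|s0] := eqVneq (s + t) 0.
  have -> : s *: x + t *: y + r *: z = 2 *: (2^-1 *: z + 2^-1 *: (s *: x + (1 - s) *: y)) + (-1) *: y.
    by apply/rowP => c; rewrite !mxE (_ : t = - s) 1?(_ : r = 1); [field|lra|lra].
  rewrite !polar_comb //; [|lra..].
  by rewrite (_ : t = - s) 1?(_ : r = 1); [field|lra|lra].
have -> : s *: x + t *: y + r *: z =
    (s + t) *: ((s / (s + t)) *: x + (t / (s + t)) *: y) + r *: z.
  by apply/rowP => c; rewrite !mxE; field.
by rewrite !polar_comb //; field.
Qed.

Definition contact1 P Q p := peval P p = peval Q p /\
  forall c, peval (mderiv c P) p = peval (mderiv c Q) p.

Lemma contact1_polar P Q p : cubic P -> cubic Q -> contact1 P Q p ->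
  forall x, polar P p p x = polar Q p p x.
Proof.
move=> cP cQ [e0 e1] x; have -> : x = p + (x - p) by rewrite addrC subrK.
have := polar_deriv p (x - p) cP; have := polar_deriv p (x - p) cQ.
by rewrite !sum_ord2 !e1 e0; lra.
Qed.

(** Contact is assumed on the segment only, while [s] and [t] range over all reals: this is what
    lets the blossoms be compared at points of the line beyond the common edge. *)
Lemma contact1_segment P Q p q : cubic P -> cubic Q ->
  (forall s, 0 <= s <= 1 -> contact1 P Q ((1 - s) *: p + s *: q)) ->
  forall s t x, polar P ((1 - s) *: p + s *: q) ((1 - t) *: p + t *: q) x =
                polar Q ((1 - s) *: p + s *: q) ((1 - t) *: p + t *: q) x.
Proof.
move=> cP cQ h s t x.
(* On the line, B(r, r, x) is a quadratic polynomial in the parameter of r, and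
   three values determine its coefficients. *)
have expand (F : mpoly 2 R) a b : cubic F ->
    polar F ((1 - a) *: p + a *: q) ((1 - b) *: p + b *: q) x =
    (1 - a) * (1 - b) * polar F p p x + (a + b - 2 * a * b) * polar F p q x
    + a * b * polar F q q x.
  move=> cF; rewrite polarC23 polar_comb //; last by ring.
  rewrite 2!(polarC23 _ _ x) 2!(polarC12 _ ((1 - a) *: p + a *: q)).
  rewrite !(polarC23 _ _ (_ + _)) !polar_comb //; [|ring..].
  by rewrite !(polarC23 _ _ x) (polarC12 _ q p); ring.
have e a : 0 <= a <= 1 -> _ := fun ha => contact1_polar cP cQ (h a ha) x.
have := e 0; have := e 1; have := e 2^-1.
rewrite !expand //.
move=> /(_ ltac:(lra)) e1 /(_ ltac:(lra)) e2 /(_ ltac:(lra)) e3.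
have epp : polar P p p x = polar Q p p x by lra.
have eqq : polar P q q x = polar Q q q x by lra.
have -> : polar P p q x = polar Q p q x by lra.
by rewrite epp eqq.
Qed.

(* Twice the signed area of the triangle [x, y, z]. *)
Definition cross x y z : R :=
  (y ord0 0 - x ord0 0) * (z ord0 1 - x ord0 1)
  - (y ord0 1 - x ord0 1) * (z ord0 0 - x ord0 0).

Lemma ord2_cases (c : 'I_2) : c = 0 \/ c = 1.
Proof. by case: c => -[|[|//]] h; [left|right]; exact: val_inj. Qed.

(** Cramer's rule: the weights are ratios of signed areas. *)
Lemma barycentric x y z p : cross x y z != 0 ->
  p = (cross p y z / cross x y z) *: x + (cross x p z / cross x y z) *: y
      + (cross x y p / cross x y z) *: z.
Proof.
move=> nz; apply/rowP => c; rewrite !mxE.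
by case: (ord2_cases c) => ->; move: nz; rewrite /cross => nz; field.
Qed.

Lemma barycentric_sum x y z p : cross x y z != 0 ->
  cross p y z / cross x y z + cross x p z / cross x y z
  + cross x y p / cross x y z = 1.
Proof. by rewrite /cross => nz; field. Qed.

Lemma multinom_le2_ind (F : multinom 2 -> Prop) :
  F mnm0 -> (forall c, F (mnm1 c)) ->
  (forall c d, F (mnm_add (mnm1 c) (mnm1 d))) ->
  forall m, (mdeg m <= 2)%N -> F m.
Proof.
move=> F0 F1 F2 m.
have dm : mdeg m = (m 0%R + m 1%R)%N.
  rewrite mdegE !big_ord_recl big_ord0 addn0.
  by rewrite (_ : lift ord0 ord0 = 1) //; apply: val_inj.
have eqm (m' : multinom 2) : m 0 = m' 0 -> m 1 = m' 1 -> F m' -> F m.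
  move=> e0 e1; rewrite (_ : m = m') //; apply/mnmP => c.
  by case: (ord2_cases c) => ->.
rewrite dm; case e0 : (m 0) => [|[|[|a]]]; case e1 : (m 1) => [|[|[|b]]] // _.
- by apply: eqm F0; rewrite ?e0 ?e1 mnmE.
- by apply: eqm (F1 1); rewrite ?e0 ?e1 mnmE.
- by apply: eqm (F2 1 1); rewrite ?e0 ?e1 mnmDE !mnm1E.
- by apply: eqm (F1 0); rewrite ?e0 ?e1 mnmE.
- by apply: eqm (F2 0 1); rewrite ?e0 ?e1 mnmDE !mnm1E.
- by apply: eqm (F2 0 0); rewrite ?e0 ?e1 mnmDE !mnm1E.
Qed.

(** Once the blossoms agree with two arguments on the line, second derivatives are governed by the
    values with a single argument there. Affinity in that argument leaves its values at [p] and [q],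
    and since [u] and [w] are off the line, one value suffices for each. *)
Lemma contact2_segment P Q p q u w : cubic P -> cubic Q ->
  (forall s, 0 <= s <= 1 -> contact1 P Q ((1 - s) *: p + s *: q)) ->
  cross p q u != 0 -> cross p q w != 0 ->
  (forall s m, 0 <= s <= 1 -> (mdeg m <= 2)%N ->
     peval (mderivm m P) ((1 - s) *: p + s *: q) =
     peval (mderivm m Q) ((1 - s) *: p + s *: q)) <->
  polar P p u w = polar Q p u w /\ polar P q u w = polar Q q u w.
Proof.
move=> cP cQ h nu nw; have h1 := contact1_segment cP cQ h.
have at0 : (1 - 0) *: p + 0 *: q = p by rewrite subr0 scale1r scale0r addr0.
have at1 : (1 - 1) *: p + 1 *: q = q by rewrite subrr scale1r scale0r add0r.
split=> [h2|[hp hq]].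
  (* In directions [u - r] and [w - r], all terms of the second difference but the one at
     [(r, u, w)] are fixed by first order contact. *)
  have e s : 0 <= s <= 1 -> let r := (1 - s) *: p + s *: q in
      polar P r u w = polar Q r u w.
    move=> hs r; have [e0 _] := h s hs.
    have eu := h1 s s u; have ew := h1 s s w.
    have := polar_deriv2 r (u - r) (w - r) cP.
    have := polar_deriv2 r (u - r) (w - r) cQ.
    have hcd c d : peval (mderiv c (mderiv d P)) r = peval (mderiv c (mderiv d Q)) r.
      by rewrite -!mderivmU1m -!mderivmDm h2 // mdegD !mdeg1.
    rewrite !sum_ord2 !hcd !(addrC r) !subrK.
    move: e0 eu ew; rewrite -/r; lra.
  have := e 0; have := e 1; rewrite /= at0 at1.
  by move=> /(_ ltac:(lra)) -> /(_ ltac:(lra)) ->.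
have hpq s x y : polar P ((1 - s) *: p + s *: q) x y =
                 polar Q ((1 - s) *: p + s *: q) x y.
  (* Expand [y] in the frame [p, q, w] and [x] in the frame [p, q, u]: every term except the one at
     [(a, u, w)] has a further argument [p] or [q]. *)
  have gen a : polar P a u w = polar Q a u w ->
      (forall z, polar P a p z = polar Q a p z) ->
      (forall z, polar P a q z = polar Q a q z) ->
      polar P a x y = polar Q a x y.
    move=> euw ep eq.
    rewrite (barycentric y nw) !polar_comb3 ?barycentric_sum //.
    rewrite !(polarC23 _ a x) ep eq.
    rewrite (barycentric x nu) !polar_comb3 ?barycentric_sum //.
    by rewrite !(polarC23 _ a w) ep eq euw.
  have gp : polar P p x y = polar Q p x y.
    by apply: gen => // z; [have := h1 0 0 z|have := h1 0 1 z]; rewrite ?at0 ?at1.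
  have gq : polar P q x y = polar Q q x y.
    by apply: gen => // z; [have := h1 1 0 z|have := h1 1 1 z]; rewrite ?at0 ?at1.
  have rot F a : polar F a x y = polar F x y a by rewrite polarC12 polarC23.
  by rewrite !rot !polar_comb -?rot ?gp ?gq //; ring.
move=> s m hs; have [e0 e1] := h s hs.
set r := (1 - s) *: p + s *: q in e0 e1 *.
move: m; apply: multinom_le2_ind => [|c|c d].
- by rewrite !mderivm0m.
- by rewrite !mderivmU1m.
rewrite !mderivmDm !mderivmU1m.
(* Along coordinate directions the double sum collapses to a single second partial. *)
have := polar_deriv2 r (delta_mx ord0 c) (delta_mx ord0 d) cP.
have := polar_deriv2 r (delta_mx ord0 c) (delta_mx ord0 d) cQ.
rewrite !hpq e0 => -> .
rewrite !sum_ord2 !mxE.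
case: (ord2_cases c) => ->; case: (ord2_cases d) => -> /=;
  by rewrite !(mul0r, mul1r, mulr0, mulr1, add0r, addr0).
Qed.

End Contact.

(** * Gradients of polynomial pieces as limits of the gradient of a $C^1$ function *)

Section Gradients.
Variable R : realType.
Implicit Types (P Q : mpoly 2 R) (x y z p q r u w : plane R).

Lemma peval_continuous P : continuous (peval P : plane R -> R).
Proof.
rewrite (mpolyE P); elim/big_ind: _ => [|P1 P2 h1 h2|m _].
- rewrite (_ : peval 0 = fun=> 0); first exact: cst_continuous.
  by apply/funext => p; rewrite peval0.
- rewrite (_ : peval _ = peval P1 \+ peval P2); last first.
    by apply/funext => p; rewrite pevalD.
  by move=> p; apply: continuousD; [exact: h1|exact: h2].
pose X d n := fun p : plane R => p ord0 d ^+ n.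
have cX d n : continuous (X d n).
  move=> p; apply: (@continuous_comp _ _ _ (fun p : plane R => p ord0 d) (@GRing.exp R ^~ n)).
    exact: coord_continuous.
  exact: exprn_continuous.
rewrite (_ : peval _ = cst (mcoeff m P) \* (X 0 (m 0) \* X 1 (m 1))).
  move=> p; apply: continuousM; first exact: cst_continuous.
  by apply: continuousM; exact: cX.
by apply/funext => p; rewrite pevalZ pevalXE.
Qed.

Lemma derive_peval P p c : cubic P ->
  'D_(delta_mx ord0 c) (peval P : plane R -> R) p = peval (mderiv c P) p.
Proof.
move=> cP; set v : plane R := delta_mx ord0 c.
(* The Bernstein expansion of the blossom at [(1 - h) p + h (p + v)], sorted by powers of [h]; the
   linear coefficient is the formal derivative. *)
have key h : peval P (h *: v + p) = peval P p + h * peval (mderiv c P) p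
    + h ^+ 2 * (3 * (polar P p (p + v) (p + v) - 2 * polar P p p (p + v) + peval P p)
      + h * (polar P (p + v) (p + v) (p + v) - 3 * polar P p (p + v) (p + v)
             + 3 * polar P p p (p + v) - peval P p)).
  have -> : peval (mderiv c P) p = 3 * (polar P p p (p + v) - peval P p).
    rewrite polar_deriv // sum_ord2 !mxE.
    by case: (ord2_cases c) => -> /=; rewrite !(mul0r, mul1r, add0r, addr0).
  have -> : h *: v + p = (1 - h) *: p + h *: (p + v).
    by apply/rowP => d; rewrite !mxE; ring.
  set q := p + v; set m := _ + _.
  have e1 a b : polar P a b m = (1 - h) * polar P a b p + h * polar P a b q.
    by apply: polar_comb => //; ring.
  have e2 a : polar P m m a = (1 - h) * polar P m a p + h * polar P m a q.
    by rewrite polarC23 e1.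
  have e3 a b : polar P m a b = (1 - h) * polar P a b p + h * polar P a b q.
    by rewrite polarC12 polarC23 e1.
  rewrite -!polar_diag e1 !e2 !e3.
  rewrite (polarC23 P q q p) (polarC12 P q p q) (polarC12 P q p p) (polarC23 P p q p).
  by ring.
rewrite /derive.
set A := 3 * _ in key; set B := polar P _ _ _ - _ + _ - _ in key.
apply: cvg_lim => //.
(* The difference quotient, extended continuously to [h = 0]. *)
pose f h := peval (mderiv c P) p + h * (A + h * B).
have cf : continuous f.
  move=> h; apply: cvgD; first exact: cvg_cst.
  apply: cvgM => //; apply: cvgD; first exact: cvg_cst.
  by apply: cvgM => //; exact: cvg_cst.
have lim0 : f @ 0^' --> peval (mderiv c P) p.
  have <- : f 0 = peval (mderiv c P) p by rewrite /f mul0r addr0.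
  by apply: cvg_trans (cf 0); apply: cvg_app; exact: cvg_within.
apply: cvg_trans lim0; apply: near_eq_cvg.
near=> h.
have h0 : h != 0 by near: h; exact: nbhs_dnbhs_neq.
by rewrite /= key /f; rewrite (_ : forall a b : R, a *: b = a * b) //; field.
Unshelve. all: by end_near. Qed.

Lemma chull3P x y z p : chull [:: x; y; z] p <-> exists a b c : R,
  [/\ 0 <= a, 0 <= b & 0 <= c] /\ a + b + c = 1 /\ p = a *: x + b *: y + c *: z.
Proof.
rewrite /chull /hull /=; split=> [[w [w0 w1 ->]]|[a [b [c [[a0 b0 c0] [s1 ->]]]]]].
  exists (w 0), (w 1), (w (inord 2)); split; first by [].
  have e (V : zmodType) (f : 'I_3 -> V) : \sum_(i in [set: 'I_3]%SET) f i = f 0 + f 1 + f (inord 2).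
    rewrite (eq_bigl predT); last by move=> i; rewrite inE.
    rewrite !big_ord_recl big_ord0 addr0 addrA; congr (_ + f _ + f _); apply: val_inj => //=.
    by rewrite inordK.
  by move: w1; rewrite !e inordK //= => <-.
exists (fun i => nth 0 [:: a; b; c] i); split.
- by case=> -[|[|[|]]].
- rewrite (eq_bigl predT); last by move=> i; rewrite inE.
  by rewrite !big_ord_recl big_ord0 addr0 addrA.
- rewrite (eq_bigl predT); last by move=> i; rewrite inE.
  by rewrite !big_ord_recl big_ord0 addr0 addrA.
Qed.

Lemma chull2P x y p : chull [:: x; y] p <-> exists s : R,
  0 <= s <= 1 /\ p = (1 - s) *: x + s *: y.
Proof.
rewrite /chull /hull /=; split=> [[w [w0 w1 ->]]|[s [/andP[s0 s1] ->]]].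
  have e (V : zmodType) (f : 'I_2 -> V) : \sum_(i in [set: 'I_2]%SET) f i = f 0 + f 1.
    rewrite (eq_bigl predT); last by move=> i; rewrite inE.
    exact: sum_ord2.
  move: w1; rewrite !e => w1; exists (w 1).
  have -> : 1 - w 1 = w 0 by lra.
  by split=> //; have := w0 0; have := w0 1; lra.
exists (fun i => nth 0 [:: 1 - s; s] i); split.
- by case=> -[|[|]] //= _; rewrite subr_ge0.
- rewrite (eq_bigl predT); last by move=> i; rewrite inE.
  by rewrite !big_ord_recl big_ord0 addr0 /= subrK.
- rewrite (eq_bigl predT); last by move=> i; rewrite inE.
  by rewrite !big_ord_recl big_ord0 addr0.
Qed.

Lemma cross_continuous1 y z : continuous (fun p : plane R => cross p y z).
Proof.
pose X d p : R := p ord0 d.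
have cX a d p : {for p, continuous (cst a \- X d)}.
  apply: continuousB; first exact: cst_continuous.
  exact: coord_continuous.
move=> p; rewrite (_ : (fun p => _) = (cst (y ord0 0) \- X 0) \* (cst (z ord0 1) \- X 1)
  \- (cst (y ord0 1) \- X 1) \* (cst (z ord0 0) \- X 0)) //.
by apply: continuousB; apply: continuousM; exact: cX.
Qed.

Lemma crossC x y z : cross x y z = cross y z x.
Proof. by rewrite /cross; ring. Qed.

Lemma cross_comb x y z (a b c : R) : a + b + c = 1 ->
  cross (a *: x + b *: y + c *: z) y z = a * cross x y z.
Proof. by move=> s1; rewrite /cross !mxE (_ : a = 1 - b - c); [ring|lra]. Qed.

(** Barycentric coordinates are continuous, so positive ones stay positive nearby. *)
Lemma chull3_nbhs x y z (a b c : R) : cross x y z != 0 ->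
  [/\ 0 < a, 0 < b & 0 < c] -> a + b + c = 1 ->
  \forall q \near a *: x + b *: y + c *: z, chull [:: x; y; z] q.
Proof.
move=> nz [a0 b0 c0] s1; set p := _ + _ + _.
have pos (u w t : plane R) (s : R) : cross u w t = cross x y z -> 0 < s ->
    cross p w t / cross x y z = s -> \forall q \near p, 0 < cross q w t / cross x y z.
  move=> e s0 es.
  have /cvgr_gt : {for p, continuous ((fun q => cross q w t) \* cst (cross x y z)^-1)}.
    by apply: continuousM; [exact: cross_continuous1|exact: cst_continuous].
  by move=> /(_ 0); rewrite /= es; apply.
have pa : cross p y z / cross x y z = a by rewrite cross_comb // mulfK.
have pb : cross p z x / cross x y z = b.
  rewrite /p (_ : _ + _ = b *: y + c *: z + a *: x); last by rewrite [RHS]addrC addrA.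
  by rewrite cross_comb; [rewrite -(crossC x y z) mulfK|lra].
have pc : cross p x y / cross x y z = c.
  rewrite /p (_ : _ + _ = c *: z + a *: x + b *: y); last by rewrite [RHS]addrAC addrC addrA addrAC.
  by rewrite cross_comb; [rewrite (crossC z x y) mulfK|lra].
near=> q; apply/chull3P.
exists (cross q y z / cross x y z), (cross x q z / cross x y z), (cross x y q / cross x y z).
have qa : 0 < cross q y z / cross x y z by near: q; exact: (pos x _ _ a).
have qb : 0 < cross q z x / cross x y z.
  by near: q; apply: (pos y _ _ b) => //; rewrite -crossC.
have qc : 0 < cross q x y / cross x y z.
  by near: q; apply: (pos z _ _ c) => //; rewrite crossC.
rewrite (crossC x q) -(crossC q x y); split; last split.
- by split; exact: ltW.
- by have := barycentric_sum q nz; rewrite (crossC x q) -(crossC q x y).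
- by have := barycentric q nz; rewrite (crossC x q) -(crossC q x y).
Unshelve. all: by end_near. Qed.

(** Inside the triangle [S] coincides with [P] near each point, so [g] is the derivative of [P];
    continuity of [g] carries this to the sides, including those on the boundary of [Omega]. *)
Lemma gradient_limit (Omega : set (plane R)) (S : plane R -> R) P x y z c
    (g : plane R -> R) :
  cubic P -> cross x y z != 0 -> chull [:: x; y; z] `<=` Omega ->
  (forall p, chull [:: x; y; z] p -> S p = peval P p) ->
  {within Omega, continuous g} ->
  (forall p, interior Omega p -> is_derive p (delta_mx ord0 c) S (g p)) ->
  forall r, chull [:: x; y; z] r -> g r = peval (mderiv c P) r.
Proof.
move=> cP nz sub SP cg dg r hr.
have inner (a b d : R) : [/\ 0 < a, 0 < b & 0 < d] -> a + b + d = 1 ->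
    g (a *: x + b *: y + d *: z) = peval (mderiv c P) (a *: x + b *: y + d *: z).
  move=> pos s1; have nb := chull3_nbhs nz pos s1.
  set p := _ + _ + _ in nb *.
  have ip : interior Omega p by apply: filterS nb => q /sub.
  have [dv e] := dg p ip.
  rewrite -e -derive_peval //; apply: near_eq_derive.
  by apply: filterS nb => q /SP.
have [a [b [d [[a0 b0 d0] [s1 rE]]]]] := (chull3P x y z r).1 hr.
(* A boundary point is approached along the segment to the centroid, which is interior to the
   triangle for [0 < t < 1]. *)
pose m := 3^-1 *: x + 3^-1 *: y + 3^-1 *: z.
pose seg (t : R) := (1 - t) *: r + t *: m.
have segE t : seg t = ((1 - t) * a + t / 3) *: x + ((1 - t) * b + t / 3) *: y
                      + ((1 - t) * d + t / 3) *: z.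
  by apply/rowP => l; rewrite /seg /m rE !mxE; field.
have seg0 : seg 0 = r by rewrite /seg subr0 scale1r scale0r addr0.
have cseg : seg @ 0^'+ --> r.
  have : continuous seg.
    move=> t; apply: cvgD; apply: cvgZr_tmp.
    - by apply: cvgB => //; exact: cvg_cst.
    - by [].
  by rewrite -seg0 => h0; apply: cvg_trans (h0 0); apply: cvg_app; exact: cvg_within.
have seg_in t : 0 < t < 1 -> [/\ 0 < (1 - t) * a + t / 3, 0 < (1 - t) * b + t / 3
    & 0 < (1 - t) * d + t / 3] by move=> ht; split; nra.
have seg_sum t : (1 - t) * a + t / 3 + ((1 - t) * b + t / 3) + ((1 - t) * d + t / 3) = 1.
  by rewrite (_ : a = 1 - b - d); [field|lra].
have lim1 : (g \o seg) @ 0^'+ --> g r.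
  have /subspace_continuousP /(_ r (sub _ hr)) cgr := cg.
  apply: (@cvg_comp _ _ _ seg g _ (within Omega (nbhs r))) => //.
  move=> A /cseg; rewrite /fmap /= /nbhs /= => hA.
  near=> t.
  have At : (fun t => Omega (seg t) -> A (seg t)) t by near: t; exact: hA.
  apply: At; apply: sub; rewrite segE; apply/chull3P.
  have ht : 0 < t < 1.
    apply/andP; split; near: t; [exact: nbhs_right_gt|exact: nbhs_right_lt].
  exists ((1 - t) * a + t / 3), ((1 - t) * b + t / 3), ((1 - t) * d + t / 3).
  by have [? ? ?] := seg_in t ht; split; [split; exact: ltW|].
have lim2 : (g \o seg) @ 0^'+ --> peval (mderiv c P) r.
  have : (peval (mderiv c P) \o seg) @ 0^'+ --> peval (mderiv c P) r.
    by apply: cvg_comp cseg _; exact: peval_continuous.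
  apply: cvg_trans; apply: near_eq_cvg; near=> t.
  have ht : 0 < t < 1.
    apply/andP; split; near: t; [exact: nbhs_right_gt|exact: nbhs_right_lt].
  by rewrite /= segE; apply/esym/inner; [exact: seg_in|exact: seg_sum].
exact: cvg_unique lim1 lim2.
Unshelve. all: by end_near. Qed.

End Gradients.

(** * Edges and triangles as index sets *)

Section IndexSets.
Variable I : finType.
Implicit Types i j k : I.

Lemma esetC i j : eset i j = eset j i.
Proof. exact: finset.setUC. Qed.

Lemma tsetC12 i j k : tset i j k = tset j i k.
Proof. by congr (_ :|: _)%SET; exact: finset.setUC. Qed.

Lemma tsetC23 i j k : tset i j k = tset i k j.
Proof. exact: finset.setUAC. Qed.

Lemma card_tset i j k : #|tset i j k| = 3 -> [/\ i != j, i != k & j != k].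
Proof.
rewrite /tset finset.setUC cardsU1 cards2 !inE (eq_sym k i) (eq_sym k j).
by case: (i == j) (i == k) (j == k) => -[] [].
Qed.

Lemma sum_tset (V : zmodType) (f : I -> V) i j k : #|tset i j k| = 3 ->
  \sum_(l in tset i j k) f l = f i + f j + f k.
Proof.
move=> /card_tset[ij ik jk].
rewrite /tset -finset.setUA big_setU1 ?inE ?negb_or ?ij //=.
by rewrite big_setU1 ?inE //= big_set1 addrA.
Qed.

End IndexSets.

(** * Geometry of the Powell-Sabin triangles *)

Section Refinement.
Variables (R : realType) (Omega : set (plane R)) (D : triangulation Omega).
Variable PS : ps_refinement D.
Local Notation v := (@vtx _ _ D).
Implicit Types i j k : vidx D.

Section Triangle.
Variables i j k : vidx D.
Hypothesis ht : tset i j k \in triangles D.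
Local Notation z := (vsplit PS (tset i j k)).
Local Notation m := (vmid PS (eset i j)).

Lemma triangle_edge : eset i j \in edges D.
Proof.
apply: (triangle_sides ht); first exact: finset.subsetUl.
by have [ij _ _] := card_tset (triangle_card ht); rewrite cards2 ij.
Qed.

Lemma cross_triangle : cross (v i) (v j) (v k) != 0.
Proof.
apply/eqP => c0; apply: (triangle_nondegenerate ht).
have [ij _ _] := card_tset (triangle_card ht).
exists (v i), (v j - v i) => x; rewrite !inE => /or3P[]/eqP->.
- by exists 0; rewrite scale0r addr0.
- by exists 1; rewrite scale1r addrC subrK.
have cE : (v j ord0 0 - v i ord0 0) * (v k ord0 1 - v i ord0 1) =
          (v j ord0 1 - v i ord0 1) * (v k ord0 0 - v i ord0 0).
  by move: c0; rewrite /cross; lra.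
(* The ratio is read off a nonvanishing coordinate of [v j - v i]; if both vanish, injectivity of
   the vertices is violated. *)
have [x0|x0] := eqVneq (v j ord0 0 - v i ord0 0) 0; last first.
  exists ((v k ord0 0 - v i ord0 0) / (v j ord0 0 - v i ord0 0)).
  apply/rowP => c; rewrite !mxE; case: (ord2_cases c) => ->; first by field.
  rewrite mulrAC (mulrC (v k ord0 0 - _)) -cE; field; exact: x0.
have [y0|y0] := eqVneq (v j ord0 1 - v i ord0 1) 0; last first.
  exists ((v k ord0 1 - v i ord0 1) / (v j ord0 1 - v i ord0 1)).
  apply/rowP => c; rewrite !mxE; case: (ord2_cases c) => ->; last by field.
  rewrite mulrAC (mulrC (v k ord0 1 - _)) cE; field; exact: y0.
move: ij; rewrite (_ : i = j) ?eqxx //; apply: (@vtx_inj _ _ D).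
by apply/rowP => c; case: (ord2_cases c) => ->; lra.
Qed.

Lemma vmidE : exists2 s, 0 < s < 1 & m = (1 - s) *: v i + s *: v j.
Proof.
have [w [w0]] := vmid_inside PS triangle_edge.
have [ij _ _] := card_tset (triangle_card ht).
rewrite /eset !big_setU1 ?inE //= !big_set1 => w1 ->.
by exists (w j); [have := w0 i; have := w0 j; lra|rewrite -w1 addrK].
Qed.

Lemma vsplitE : exists a b c : R, [/\ 0 < a, 0 < b & 0 < c] /\ a + b + c = 1 /\
  z = a *: v i + b *: v j + c *: v k.
Proof.
have [w [w0]] := vsplit_inside PS ht; rewrite !sum_tset ?(triangle_card ht) // => w1 ->.
by exists (w i), (w j), (w k).
Qed.

Lemma cross_ps_triangle : cross (v i) m z != 0.
Proof.
have [s /andP[s0 _] ->] := vmidE; have [a [b [c [[_ _ c0] [s1 ->]]]]] := vsplitE.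
have -> : cross (v i) ((1 - s) *: v i + s *: v j) (a *: v i + b *: v j + c *: v k)
    = s * c * cross (v i) (v j) (v k).
  by rewrite /cross !mxE (_ : a = 1 - b - c); [ring|lra].
by rewrite !mulf_neq0 ?cross_triangle ?gt_eqF.
Qed.

Lemma vsplit_neq_vmid : z != m.
Proof.
apply: contra_neq cross_ps_triangle => /eqP/eqP <-.
by rewrite /cross; ring.
Qed.

(** Supplies the off-line conditions of [contact2_segment] for the spoke from [v i] to the split
    point. *)
Lemma cross_spoke : cross (v i) z (v j) != 0 /\ cross (v i) z (v k) != 0.
Proof.
have [a [b [c [[_ b0 c0] [s1 ->]]]]] := vsplitE.
have -> : cross (v i) (a *: v i + b *: v j + c *: v k) (v j)
    = - c * cross (v i) (v j) (v k).
  by rewrite /cross !mxE (_ : a = 1 - b - c); [ring|lra].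
have -> : cross (v i) (a *: v i + b *: v j + c *: v k) (v k)
    = b * cross (v i) (v j) (v k).
  by rewrite /cross !mxE (_ : a = 1 - b - c); [ring|lra].
by rewrite !mulf_neq0 ?oppr_eq0 ?cross_triangle ?gt_eqF.
Qed.

Lemma ps_triangle_sub : ps_triangle PS i j k `<=` Omega.
Proof.
move=> p /chull3P[a [b [c [[a0 b0 c0] [s1 ->]]]]].
have [s /andP[s0 s1'] ->] := vmidE.
have [a' [b' [c' [[a0' b0' c0'] [s1'' ->]]]]] := vsplitE.
have /(congr1 (fun A => A _)) -> := triangles_cover D; exists (tset i j k) => //.
have [ij ik jk] := card_tset (triangle_card ht).
(* These weights come from substituting the expansions of the edge point and the split point; the
   value 0 elsewhere meets the sign condition of [hull], which covers all indices. *)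
exists (fun l => if l == i then a + b * (1 - s) + c * a' else
  if l == j then b * s + c * b' else if l == k then c * c' else 0).
split.
- move=> l; case: ifP => _; first by nra.
  by case: ifP => _; [nra|case: ifP => _; [nra|]].
- rewrite sum_tset ?(triangle_card ht) // !eqxx (eq_sym j) (eq_sym k) (eq_sym k j).
  rewrite (negbTE ij) (negbTE ik) (negbTE jk).
  by rewrite (_ : a = 1 - b - c) 1?(_ : a' = 1 - b' - c'); [ring|lra|lra].
- rewrite sum_tset ?(triangle_card ht) // !eqxx (eq_sym j) (eq_sym k) (eq_sym k j).
  rewrite (negbTE ij) (negbTE ik) (negbTE jk).
  by apply/rowP => d; rewrite !mxE; ring.
Qed.

Lemma ps_triangle_vertex : ps_triangle PS i j k (v i).
Proof.
apply/chull3P; exists 1, 0, 0; do 2?split; rewrite ?ler01 ?addr0 //.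
by rewrite scale1r !scale0r !addr0.
Qed.

Lemma ps_triangle_mid : ps_triangle PS i j k m.
Proof.
apply/chull3P; exists 0, 1, 0; do 2?split; rewrite ?ler01 ?addr0 ?add0r //.
by rewrite scale1r !scale0r add0r addr0.
Qed.

Lemma ps_triangle_split : ps_triangle PS i j k z.
Proof.
apply/chull3P; exists 0, 0, 1; do 2?split; rewrite ?ler01 ?addr0 ?add0r //.
by rewrite scale1r !scale0r !add0r.
Qed.

Lemma ps_triangle_convex p q s : ps_triangle PS i j k p -> ps_triangle PS i j k q ->
  0 <= s <= 1 -> ps_triangle PS i j k ((1 - s) *: p + s *: q).
Proof.
move=> /chull3P[a [b [c [[a0 b0 c0] [s1 ->]]]]].
move=> /chull3P[a' [b' [c' [[a0' b0' c0'] [s1' ->]]]]] hs; apply/chull3P.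
exists ((1 - s) * a + s * a'), ((1 - s) * b + s * b'), ((1 - s) * c + s * c').
split; [by split; nra|split].
  by rewrite (_ : a = 1 - b - c) 1?(_ : a' = 1 - b' - c'); [ring|lra|lra].
by apply/rowP => d; rewrite !mxE; ring.
Qed.

Lemma collinear_vmid : collinear (v k) z m ->
  exists n, v k = (1 - n) *: z + n *: m.
Proof.
move=> [x0 [d h]].
have [sk ek] := h (v k) ltac:(by rewrite !inE eqxx).
have [sz ez] := h z ltac:(by rewrite !inE eqxx orbT).
have [sm em] := h m ltac:(by rewrite !inE eqxx !orbT).
have ne : sm - sz != 0.
  by rewrite subr_eq0; apply: contra_neq vsplit_neq_vmid => e; rewrite ez em e.
exists ((sk - sz) / (sm - sz)); rewrite ek ez em.
by apply/rowP => c; rewrite !mxE; field.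
Qed.

(** The weight is a choice, so a solution has to be exhibited. At an interior edge the edge point
    lies between the two split points, so its line is also the line through them. *)
Lemma nuP k' : collinear (v k) z m ->
  (eset i j \notin bedges D -> tset i j k' \in triangles D /\ tset i j k' <> tset i j k) ->
  v k = (1 - nu PS i j k k') *: z + nu PS i j k k' *:
    (if eset i j \in bedges D then m else vsplit PS (tset i j k')).
Proof.
move=> hc hk'; rewrite /nu; set A := [set n | _].
apply: (@xgetPex _ 0 A); rewrite /A /=.
have [n nE] := collinear_vmid hc.
case: ifPn => [_|nb]; first by exists n.
have [ht' ne] := hk' nb.
have hm : (chull [:: z; vsplit PS (tset i j k')] `&` hull v (eset i j)) m.
  rewrite (@vmid_interior _ _ _ PS (eset i j)) ?triangle_edge //.
  - by apply/eqP => e; exact: ne.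
  - exact: finset.subsetUl.
  - exact: finset.subsetUl.
have [/chull2P[s [_ mE]] _] := hm.
(* Substituting the edge point, at parameter [s] between the split points, scales the weight [n] by
   [s]. *)
by exists (n * s); rewrite nE mE; apply/rowP => c; rewrite !mxE; ring.
Qed.

End Triangle.

(** * Blossoms of adjacent spline pieces *)

Section Spline.
Variable S : plane R -> R.
Hypothesis hS : ps_spline PS S.
Local Notation P i j k := (piece S (ps_triangle PS i j k)).

Lemma pieceP i j k : tset i j k \in triangles D ->
  cubic (P i j k) /\ forall p, ps_triangle PS i j k p -> S p = peval (P i j k) p.
Proof.
move=> ht; have [Q cQ SQ] := hS.2 i j k ht.
apply: (@xgetPex _ 0 [set Q | cubic Q /\ forall p, ps_triangle PS i j k p -> S p = peval Q p]).
by exists Q.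
Qed.

Lemma cubic_piece i j k : tset i j k \in triangles D -> cubic (P i j k).
Proof. by move=> /pieceP[]. Qed.

Lemma contact1_pieces i j k i' j' k' r :
  tset i j k \in triangles D -> tset i' j' k' \in triangles D ->
  ps_triangle PS i j k r -> ps_triangle PS i' j' k' r ->
  contact1 (P i j k) (P i' j' k') r.
Proof.
move=> ht ht' hr hr'; have [cP SP] := pieceP ht; have [cQ SQ] := pieceP ht'.
split=> [|c]; first by rewrite -SP // -SQ.
have [_ /(_ c)[g cg dg]] := hS.1.
rewrite -(gradient_limit cP (cross_ps_triangle ht) (ps_triangle_sub ht) SP cg dg hr).
by rewrite -(gradient_limit cQ (cross_ps_triangle ht') (ps_triangle_sub ht') SQ cg dg hr').
Qed.

Lemma contact1_common_edge i j k i' j' k' p q :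
  tset i j k \in triangles D -> tset i' j' k' \in triangles D ->
  ps_triangle PS i j k p -> ps_triangle PS i j k q ->
  ps_triangle PS i' j' k' p -> ps_triangle PS i' j' k' q ->
  forall s, 0 <= s <= 1 ->
  contact1 (P i j k) (P i' j' k') ((1 - s) *: p + s *: q).
Proof.
move=> ht ht' ? ? ? ? s hs.
by apply: contact1_pieces => //; exact: ps_triangle_convex.
Qed.

Lemma polar_common_edge i j k i' j' k' p q (s t : R) a b x :
  tset i j k \in triangles D -> tset i' j' k' \in triangles D ->
  ps_triangle PS i j k p -> ps_triangle PS i j k q ->
  ps_triangle PS i' j' k' p -> ps_triangle PS i' j' k' q ->
  a = (1 - s) *: p + s *: q -> b = (1 - t) *: p + t *: q ->
  polar (P i j k) a b x = polar (P i' j' k') a b x.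
Proof.
move=> ht ht' hp hq hp' hq' -> ->; apply: contact1_segment; try exact: cubic_piece.
exact: contact1_common_edge.
Qed.

Lemma polar_half_edge i j k k' x :
  tset i j k \in triangles D -> tset i j k' \in triangles D ->
  polar (P i j k) (v i) (v j) x = polar (P i j k') (v i) (v j) x.
Proof.
move=> ht ht'; have [s /andP[s0 s1] mE] := vmidE ht.
(* The edge point has parameter [s] between [v i] and [v j]; measured from [v i] to the edge point,
   [v j] therefore has parameter [s^-1], beyond the common half-edge. *)
apply: (@polar_common_edge _ _ _ _ _ _ (v i) (vmid PS (eset i j)) 0 s^-1) => //.
- exact: ps_triangle_vertex.
- exact: ps_triangle_mid.
- exact: ps_triangle_vertex.
- exact: ps_triangle_mid.
- by rewrite subr0 scale1r scale0r addr0.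
- by rewrite mE; apply/rowP => c; rewrite !mxE; field; rewrite gt_eqF.
Qed.

Lemma polar_vertex i j k k' :
  tset i j k \in triangles D ->
  collinear (v k) (vsplit PS (tset i j k)) (vmid PS (eset i j)) ->
  (eset i j \notin bedges D -> tset i j k' \in triangles D /\ tset i j k' <> tset i j k) ->
  (1 - nu PS i j k k') * beta_t PS S i j k + nu PS i j k k' * b_val PS S i j k' =
  polar (P i j k) (v i) (v j) (v k).
Proof.
move=> ht hc hk'; have cP := cubic_piece ht.
rewrite (nuP ht hc hk') polar_comb //; last by ring.
rewrite /beta_t /b_val !blossomE //; congr (_ + _ * _).
case: ifPn => [bd|nb]; last first.
  have [ht' _] := hk' nb.
  by rewrite /beta_t blossomE ?(polar_half_edge _ ht ht') //; exact: cubic_piece.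
(* The default 0 is excluded because [k] itself qualifies; the chosen triangle [l] shares the
   half-edge, so the two blossoms agree. *)
rewrite /beta_e; case: pickP => [l hl|/(_ k)]; last by rewrite ht.
by rewrite blossomE ?(polar_half_edge _ ht hl) //; exact: cubic_piece.
Qed.

Lemma polar_split i j k :
  tset i j k \in triangles D ->
  collinear (v k) (vsplit PS (tset i j k)) (vmid PS (eset i j)) ->
  polar (P i j k) (vsplit PS (tset i j k)) (v j) (v k) = beta_t PS S j k i.
Proof.
move=> ht hc; set z := vsplit PS _.
have ht1 : tset j i k \in triangles D by rewrite tsetC12.
have ht2 : tset j k i \in triangles D by rewrite tsetC23.
have z1 : z = vsplit PS (tset j i k) by rewrite tsetC12.
have z2 : z = vsplit PS (tset j k i) by rewrite tsetC23.
have [n kE] := collinear_vmid ht hc.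
(* Crossing from the split point to the edge point: [v k] lies on that line at parameter [n]. *)
have e1 : polar (P i j k) z (v k) (v j) = polar (P j i k) z (v k) (v j).
  apply: (@polar_common_edge _ _ _ _ _ _ z (vmid PS (eset i j)) 0 n) => //.
  - exact: ps_triangle_split.
  - exact: ps_triangle_mid.
  - rewrite z1; exact: ps_triangle_split.
  - rewrite esetC; exact: ps_triangle_mid.
  - by rewrite subr0 scale1r scale0r addr0.
(* Crossing the spoke from the split point to [v j], which are themselves two arguments. *)
have e2 : polar (P j i k) z (v j) (v k) = polar (P j k i) z (v j) (v k).
  apply: (@polar_common_edge _ _ _ _ _ _ z (v j) 0 1) => //.
  - rewrite z1; exact: ps_triangle_split.
  - exact: ps_triangle_vertex.
  - rewrite z2; exact: ps_triangle_split.
  - exact: ps_triangle_vertex.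
  - by rewrite subr0 scale1r scale0r addr0.
  - by rewrite subrr scale1r scale0r add0r.
rewrite polarC23 e1 polarC23 e2 /beta_t -z2 blossomE; last exact: cubic_piece.
by rewrite polarC12 polarC23.
Qed.

End Spline.
End Refinement.

Theorem proposition8 (R : realType) (Omega : set 'rV[R]_2)
    (D : triangulation Omega) (PS : ps_refinement D)
    (i j k : vidx D) (ht : tset i j k \in triangles D)
    (k' j' : vidx D)
    (ha : collinear (vtx k) (vsplit PS (tset i j k)) (vmid PS (eset i j)))
    (hk' : eset i j \notin bedges D ->
       tset i j k' \in triangles D /\ tset i j k' <> tset i j k)
    (hb : collinear (vtx j) (vsplit PS (tset i j k)) (vmid PS (eset k i)))
    (hj' : eset k i \notin bedges D ->
       tset k i j' \in triangles D /\ tset k i j' <> tset i j k)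
    (S : 'rV[R]_2 -> R) (hS : ps_spline PS S) :
  C2_across S (ps_triangle PS i j k) (ps_triangle PS i k j)
    (chull [:: vtx i; vsplit PS (tset i j k)])
  <->
  (1 - nu PS i j k k') * beta_t PS S i j k + nu PS i j k k' * b_val PS S i j k'
    = (1 - nu PS k i j j') * beta_t PS S i k j
      + nu PS k i j j' * b_val PS S i k j'
  /\ beta_t PS S j k i = beta_t PS S k j i.
Proof.
have ht' : tset i k j \in triangles D by rewrite tsetC23.
(* The data at the edge [k i] are rewritten as those at [i j] with [j] and [k] exchanged, so that
   the same lemmas serve both pieces. *)
have nuC : nu PS k i j j' = nu PS i k j j'.
  by rewrite /nu esetC (tsetC12 k i j) (tsetC12 k i j').
rewrite tsetC23 (esetC k i) in hb.
have hj : eset i k \notin bedges D ->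
    tset i k j' \in triangles D /\ tset i k j' <> tset i k j.
  by rewrite esetC tsetC12 (tsetC23 i k j).
rewrite nuC (polar_vertex hS ht ha hk') (polar_vertex hS ht' hb hj).
rewrite -(polar_split hS ht ha) -(polar_split hS ht' hb) -(tsetC23 i j k).
(* Both equations now compare the two blossoms at the same arguments, as [contact2_segment] requires
   with [u] and [w] the vertices [j] and [k]. *)
rewrite !(polarC23 _ _ (vtx k) (vtx j)).
have [c1 c2] := cross_spoke PS ht.
have zk : vsplit PS (tset i j k) = vsplit PS (tset i k j) by rewrite tsetC23.
have h1 : forall s, 0 <= s <= 1 -> contact1 (piece S (ps_triangle PS i j k))
    (piece S (ps_triangle PS i k j)) ((1 - s) *: vtx i + s *: vsplit PS (tset i j k)).
  apply: contact1_common_edge => //.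
  - exact: ps_triangle_vertex.
  - exact: ps_triangle_split.
  - exact: ps_triangle_vertex.
  - rewrite zk; exact: ps_triangle_split.
rewrite -(contact2_segment (cubic_piece hS ht) (cubic_piece hS ht') h1 c1 c2).
split=> [h s m hs hm|h p m /chull2P[s [hs ->]] hm]; last exact: h.
by apply: h => //; apply/chull2P; exists s.
Qed.
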